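(* For every integer $k\geq 2$, every $2k$-strong tournament is $k^{*}$-strongly connected.
   Context: A tournament is a digraph in which each pair of distinct vertices is joined by exactly one arc. A digraph is $m$-strong if it has more than $m$ vertices and remains strongly connected after deleting any set of fewer than $m$ vertices. For distinct vertices $u,v$ of a digraph $D$, a strong $k^{*}$-container between $u$ and $v$ is a set of $k$ internally disjoint paths that are either all $(u,v)$-paths or all $(v,u)$-paths, whose union contains every vertex of $D$. $D$ is $k^{*}$-strongly connected if there is a strong $k^{*}$-container between every two distinct vertices of $D$. *)

(* Defs.v *)
From mathcomp Require Import all_boot.
Set Implicit Arguments. Unset Strict Implicit. Unset Printing Implicit Defensive.

Definition tournament (V : finType) (arc : rel V) : Prop :=
  (forall x, ~~ arc x x) /\
  (forall x y, x != y -> (arc x y (+) arc y x)).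

Definition strong_on (V : finType) (arc : rel V) (S : {set V}) : Prop :=
  forall x y, x \in S -> y \in S ->
    connect [rel a b | [&& arc a b, a \in S & b \in S]] x y.

Definition m_strong (V : finType) (arc : rel V) (m : nat) : Prop :=
  m < #|V| /\ forall X : {set V}, #|X| < m -> strong_on arc (~: X).

Definition dipath (V : finType) (arc : rel V) (u v : V) (s : seq V) : Prop :=
  exists t, s = u :: t /\ path arc u t /\ last u t = v /\ uniq s.

Definition int_disjoint (V : finType) (u v : V) (s1 s2 : seq V) : Prop :=
  forall x, x \in s1 -> x \in s2 -> x = u \/ x = v.

Definition container (V : finType) (arc : rel V) (k : nat) (a b : V)
    (P : seq (seq V)) : Prop :=
  [/\ size P = k, uniq P,
      (forall s, s \in P -> dipath arc a b s),
      (forall i j, i < size P -> j < size P -> i != j ->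
         int_disjoint a b (nth [::] P i) (nth [::] P j))
    & (forall x : V, exists2 s, s \in P & x \in s)].

Definition strong_container (V : finType) (arc : rel V) (k : nat) (u v : V)
    (P : seq (seq V)) : Prop :=
  container arc k u v P \/ container arc k v u P.

Definition kstar_strongly_connected (V : finType) (arc : rel V) (k : nat) : Prop :=
  forall u v : V, u != v -> exists P, strong_container arc k u v P.

(* Main.v *)
Require Import Defs.
From mathcomp Require Import all_boot zify.
Set Implicit Arguments. Unset Strict Implicit. Unset Printing Implicit Defensive.

(* Say that u dominates v; all paths will go from u to v. By Menger's theorem there are k + 1 internally disjoint (u,v)-paths other than the arc uv itself; enlarge them as long as some uncovered vertex fits between two consecutive inner vertices. If everything gets covered, two of the paths are merged, which is always possible in a tournament. Otherwise the uncovered set W has a Hamiltonian path whose first vertex is dominated by the last inner vertex of some path P and whose last vertex dominates the first inner vertex of some path Q. If P and Q differ, they and W form one path, leaving k paths. If P = Q is forced, the path through W is cut in two and absorbed together with P and two further paths, leaving k - 1 paths to which the arc uv is added. *)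

(** * Hall's marriage theorem, and Menger's theorem between two vertex sets *)

Definition nbr (T : finType) (e : rel T) (B X : {set T}) : {set T} :=
  [set y in B | [exists x in X, e x y]].

(** Induction on [#|A|]. If some nonempty proper subset [X] is tight, [X] is matched into its
    neighbours and [A :\: X] into the rest of [B], where Hall's condition survives because it holds
    for [X :|: Y]. Otherwise every such subset has a spare neighbour, so any related pair [a], [b]
    can be matched and removed. *)
Lemma hall (T : finType) (e : rel T) (A B : {set T}) :
  (forall X : {set T}, X \subset A -> #|X| <= #|nbr e B X|) ->
  exists f : T -> T,
    {in A &, injective f} /\ forall x, x \in A -> f x \in B /\ e x (f x).
Proof.
have [n] := ubnP #|A|; elim: n A B => // n IH A B lt_A_n hallA.
have [->|[a aA]] := set_0Vmem A.
  by exists id; split=> [x y|x]; rewrite inE.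
have [/existsP[X /and3P[XA X0 tightX]]|loose] :=
  boolP [exists X : {set T}, [&& X \proper A, X != set0 & #|nbr e B X| <= #|X|]].
  have ltX := proper_card XA; have sXA := proper_sub XA.
  have [|Y YX|f [injf fP]] := IH X B; first by lia.
    by apply: hallA; apply: subset_trans sXA.
  have [| Y YX|g [injg gP]] := IH (A :\: X) (B :\: nbr e B X).
  - by rewrite cardsD (setIidPr sXA); move: X0; rewrite -card_gt0; lia.
  - have XY : X :&: Y = set0.
      apply/setP=> z; rewrite !inE; apply/andP=> -[zX /(subsetP YX)].
      by rewrite inE zX.
    have := hallA (X :|: Y); rewrite subUset sXA (subset_trans YX) ?subsetDl //.
    rewrite cardsU XY cards0 subn0 => /(_ isT) hXY.
    have : #|nbr e B (X :|: Y)| <=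
           #|nbr e B X :|: nbr e (B :\: nbr e B X) Y|.
      apply/subset_leq_card/subsetP => z; rewrite !inE.
      case/andP=> zB /exists_inP[w]; rewrite inE zB /=.
      case/orP=> [wX|wY] ewz; first by rewrite (introT exists_inP) //; exists w.
      by apply/orP; case: [exists x in X, _]; [left|right=> /=; apply/exists_inP; exists w].
    by rewrite cardsU; lia.
  exists (fun x => if x \in X then f x else g x).
  have fN x : x \in X -> f x \in nbr e B X.
    move=> xX; have [fxB efx] := fP x xX; rewrite inE fxB /=.
    by apply/exists_inP; exists x.
  have gN x : x \in A -> x \notin X -> g x \in B :\: nbr e B X /\ e x (g x).
    by move=> xA xX; apply: gP; rewrite inE xX.
  split=> [x y xA yA|x xA]; last first.
    case: ifPn => xX; first exact: fP.
    by have [] := gN x xA xX; rewrite inE => /andP[_].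
  case: ifPn => xX; case: ifPn => yX.
  - exact: injf.
  - by move=> E; have [] := gN y yA yX; rewrite inE -E (fN x xX).
  - by move=> E; have [] := gN x xA xX; rewrite inE E (fN y yX).
  - by apply: injg; rewrite inE ?xX ?yX.
have /card_gt0P[b] : 0 < #|nbr e B [set a]|.
  by apply: leq_trans (hallA [set a] _); rewrite ?cards1 // sub1set.
rewrite inE => /andP[bB /exists_inP[a']]; rewrite inE => /eqP-> eab {a'}.
have [| Y YA|f [injf fP]] := IH (A :\ a) (B :\ b).
- by move: lt_A_n; rewrite (cardsD1 a A) aA; lia.
- have [->|Y0] := eqVneq Y set0; first by rewrite cards0.
  have pY : Y \proper A.
    by apply: sub_proper_trans YA _; rewrite properD1.
  move: loose; rewrite negb_exists => /forallP/(_ Y).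
  rewrite pY Y0 /= -ltnNge => ltY.
  have : #|nbr e B Y| <= #|b |: nbr e (B :\ b) Y|.
    apply/subset_leq_card/subsetP => z; rewrite !inE => /andP[-> ->].
    by case: (z == b).
  by rewrite cardsU1; case: (b \notin _); lia.
exists (fun x => if x == a then b else f x).
have fA x : x \in A -> x != a -> f x \in B :\ b /\ e x (f x).
  by move=> xA xa; apply: fP; rewrite !inE xa.
split=> [x y xA yA|x xA]; last first.
  case: eqP => [->|/eqP xa] //.
  by have [] := fA x xA xa; rewrite inE => /andP[_].
case: eqVneq => [->|xa]; case: eqVneq => [->|ya] //.
- by move=> E; have [] := fA y yA ya; rewrite !inE -E eqxx.
- by move=> E; have [] := fA x xA xa; rewrite !inE E eqxx.
- by apply: injf; rewrite !inE ?xa ?ya.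
Qed.

Lemma uniq_flatten_map (I : finType) (T : eqType) (s : I -> seq T) (r : seq I) :
  uniq r -> (forall i, uniq (s i)) ->
  (forall i j z, z \in s i -> z \in s j -> i = j) ->
  uniq (flatten [seq s i | i <- r]).
Proof.
move=> + us ds; elim: r => //= i r IH /andP[ir ur].
rewrite cat_uniq us IH // andbT; apply/hasPn=> z /flatten_mapP[j jr zj].
by apply: contra ir => zi; rewrite (ds _ _ _ zi zj).
Qed.

(* Hall's theorem on V + 'I_k: the dummies 'I_k are sent into A and B is sent to the dummies, so the cycles of the resulting permutation are cut by the dummies into the desired paths. *)
Lemma menger (V : finType) (e : rel V) (A B : {set V}) (k : nat) :
  (forall S : {set V},
     (forall x p, x \in A -> path e x p -> last x p \in B ->
        has (mem S) (x :: p)) -> k <= #|S|) ->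
  exists F : seq (seq V), [/\ size F = k, uniq (flatten F) &
    forall s, s \in F -> exists x p,
      [/\ s = x :: p, x \in A, path e x p & last x p \in B]].
Proof.
move=> sepk.
(* The disjunct [x == y] lets a vertex on no path be matched to itself. *)
pose E (a b : V + 'I_k) := match a, b with
  | inl x, inl y => (x == y) || e x y
  | inl x, inr _ => x \in B
  | inr _, inl y => y \in A
  | inr _, inr _ => false end.
have [X _|f [injf' fE']] := @hall _ E setT setT.
  pose XV := [set x | inl x \in X]; pose XD := [set i | inr i \in X].
  have cardsum (Y : {set V + 'I_k}) :
      #|Y| = #|[set x | inl x \in Y]| + #|[set i | inr i \in Y]|.
    rewrite -!sum1_card big_sumType /=.
    by congr addn; apply: eq_bigl => z; rewrite inE.
  have sub1 : XV \subset [set x | inl x \in nbr E setT X].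
    apply/subsetP=> x; rewrite !inE => xX; apply/exists_inP.
    by exists (inl x) => //=; rewrite eqxx.
  rewrite !cardsum -/XV -/XD.
  have [XD0|[i iX]] := set_0Vmem XD.
    by rewrite XD0 cards0 addn0 (leq_trans (subset_leq_card sub1)) ?leq_addr.
  have XDk : #|XD| <= k by rewrite -[k in _ <= k]card_ord max_card.
  have [/exists_inP[x xX xB]|noB] := boolP [exists x in XV, x \in B].
    apply: leq_add; first exact: subset_leq_card.
    apply: leq_trans XDk _; rewrite -[k in k <= _]card_ord -cardsT subset_leq_card //.
    apply/subsetP=> j _; rewrite !inE; apply/exists_inP; exists (inl x) => //.
    by rewrite inE in xX.
  (* Now [X] contains a dummy and no vertex of [B]. So [A] lies in [Y], and a path from [A] avoiding
     [Y :\: XV] never leaves [XV], hence cannot end in [B]. Thus [Y :\: XV] is a separator, and its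
     at least [k] elements pay for the dummies in [X]. *)
  set Y := [set x | _].
  suff : k <= #|Y :\: XV|.
    by rewrite cardsD (setIidPr sub1); have := subset_leq_card sub1; rewrite -/Y; lia.
  apply: sepk => x p xA ep pB.
  have AY z : z \in A -> z \in Y.
    by move=> zA; rewrite !inE; apply/exists_inP; exists (inr i); rewrite inE in iX.
  have stay z q : z \in Y -> path e z q -> ~~ has (mem (Y :\: XV)) (z :: q) ->
      last z q \in XV.
    elim: q z => [|y q IH] z zY /=.
      by rewrite orbF inE zY andbT negbK.
    case/andP=> ezy pq; rewrite inE zY andbT negb_or negbK => /andP[zX nq].
    apply: (IH y) => //; rewrite !inE; apply/exists_inP; exists (inl z).
      by rewrite inE in zX.
    by rewrite /= ezy orbT.
  apply: contraR noB => noS; apply/exists_inP; exists (last x p) => //.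
  exact: stay (AY _ xA) ep noS.
have injf : injective f by move=> x y; apply: injf'; rewrite inE.
have fE x : E x (f x) by have [] := fE' x (in_setT _).
pose isr (a : V + 'I_k) := if a is inr _ then true else false.
(* From dummy [i], [f] is iterated until it first reaches a dummy again; this happens since the
   orbit of [inr i] is a cycle. *)
have seg i : exists s : seq V, map inl s = traject f (f (inr i)) (size s) /\
    isr (iter (size s).+1 f (inr i)).
  have ex_n : exists n, isr (iter n.+1 f (inr i)).
    exists (order f (inr i)).-1; rewrite prednK ?order_gt0 //.
    by rewrite iter_order.
  case: (ex_minnP ex_n) => n nr minn.
  have [s Ds] : exists s : seq V, map inl s = traject f (f (inr i)) n.
    have : all (fun a => ~~ isr a) (traject f (f (inr i)) n).
      apply/allP=> _ /trajectP[j jn ->]; rewrite -iterSr.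
      by apply/negP=> /minn; rewrite leqNgt jn.
    elim: (traject _ _ _) => [|[x|//] t IH] /=; first by exists [::].
    by move=> /IH[s <-]; exists (x :: s).
  by exists s; rewrite (_ : size s = n) // -(size_map (@inl V 'I_k) s) Ds size_traject.
have [s sP] := fin_all_exists seg.
have segE i z : z \in s i -> exists2 a, a < size (s i) & inl z = iter a.+1 f (inr i).
  have [Ds _] := sP i; move=> /(map_f (@inl V 'I_k)); rewrite Ds.
  by case/trajectP=> a la ->; exists a; rewrite // -iterSr.
have not_dummy i j a : a < size (s j) -> inr i = iter a.+1 f (inr j) -> False.
  move=> la Ei; have [Ds _] := sP j.
  have : @inr V _ i \in traject f (f (inr j)) (size (s j)).
    by apply/trajectP; exists a; rewrite // Ei iterSr.
  by rewrite -Ds => /mapP[].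
have injI n : injective (iter n f).
  by elim: n => [|n IH] x y //= /injf /IH.
(* Cancelling [a.+1] applications of [f] leaves either [a = b] and [i = j], or a dummy inside
   segment [j], which is impossible. *)
have injs i j a b : b < size (s j) -> a <= b ->
    iter a.+1 f (inr i) = iter b.+1 f (inr j) -> a = b /\ i = j.
  move=> lb le_ab; have Eb : b.+1 = a.+1 + (b - a) by lia.
  rewrite Eb iterD => /injI; case D: (b - a) => [|d].
    by case=> ->; split=> //; lia.
  by move/not_dummy=> [] //; lia.
have sU i : uniq (map (@inl V 'I_k) (s i)).
  have [-> _] := sP i; apply/(uniqP (f (inr i))) => a b; rewrite !inE size_traject => la lb.
  rewrite !nth_traject // -!iterSr => E1.
  case: (leqP a b) => [/injs h|/ltnW/injs h]; first by case: (h i i lb E1).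
  by case: (h i i la (esym E1)).
exists [seq s i | i <- enum 'I_k]; split.
- by rewrite size_map size_enum_ord.
- apply: uniq_flatten_map; first exact: enum_uniq.
    by move=> i; rewrite -(map_inj_uniq (f := @inl V 'I_k)) // => ? ? [].
  move=> i j z /segE[a la Ea] /segE[b lb Eb].
  have E1 := etrans (esym Ea) Eb.
  case: (leqP a b) => [/injs h|/ltnW/injs h]; first by case: (h i j lb E1).
  by case: (h j i la (esym E1)).
move=> _ /mapP[i _ ->]; have [Ds rs] := sP i; have Us := sU i.
case: (s i) Ds rs Us => [|x p] /=; first by move=> _; have := fE (inr i); case: (f _).
case=> Ex Dp rs Us; exists x, p; split=> //.
- by have := fE (inr i); rewrite -Ex.
(* Uniqueness rules out the disjunct [x == y] of [E], so consecutive vertices are joined by arcs. *)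
- have : fpath f (inl x) (map inl p) by rewrite Dp Ex fpath_traject.
  clear Ex Dp rs; elim: p x Us => //= y p IH x /andP[nx Us] /andP[/eqP fx fp].
  rewrite IH // andbT; have := fE (inl x); rewrite fx /=.
  by case/orP=> // /eqP xy; rewrite xy mem_head in nx.
have : iter (size p) f (f (inr i)) = inl (last x p).
  by rewrite -last_map Dp Ex last_traject.
rewrite -iterSr /= => El; rewrite El in rs.
by have := fE (inl (last x p)); case: (f _) rs.
Qed.

(** * Insertion of a vertex into a path or cycle, and Hamiltonian cycles *)

Lemma path_insertion_point (T : Type) (e : rel T) (w x : T) (p : seq T) :
  all (fun a => e a w || e w a) p ->
  has (fun a => e a w) (belast x p) -> e w (last x p) ->
  exists p1 b p2, [/\ p = p1 ++ b :: p2, e (last x p1) w & e w b].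
Proof.
elim: p x => //= b p IH x /andP[tb tp] hx ewl.
have step : has (fun a => e a w) (belast b p) ->
    exists p1 c p2, [/\ b :: p = p1 ++ c :: p2, e (last x p1) w & e w c].
  by case/(IH b tp)/(_ ewl) => p1 [c [p2 [-> e1 e2]]]; exists (b :: p1), c, p2.
(* If [x] dominates [w] but [w] does not dominate the next vertex [b], then [b] dominates [w] and
   the search moves on to [b]; it must stop because [w] dominates the last vertex. *)
case/orP: hx => [exw|]; last exact: step.
have [ewb|nwb] := boolP (e w b); first by exists [::], b, p.
case: p ewl {IH tp} step => [|c p] /= ewl step; first by rewrite ewl in nwb.
by apply: step; rewrite (negPf nwb) orbF in tb; rewrite tb.
Qed.

(** The cycle is cut open at [y] and read as a path from [y] back to [y], so that it ends in a
    vertex dominated by [w], as [path_insertion_point] requires. *)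
Lemma cycle_insert (T : eqType) (e : rel T) (c : seq T) (w x y : T) :
  {in c, forall a, e a w || e w a} -> cycle e c ->
  x \in c -> e x w -> y \in c -> e w y ->
  exists2 c', cycle e c' & perm_eq c' (w :: c).
Proof.
move=> tw ec xc exw yc ewy.
have [i c1 Dc] := rot_to yc.
have prot : perm_eq (rot i c) c by rewrite perm_rot.
have mem1 : c =i y :: c1 by move=> a; rewrite -Dc mem_rot.
have [|||p1 [b [p2 [Dp e1 e2]]]] :=
  @path_insertion_point _ e w y (rcons c1 y).
- by apply/allP=> a; rewrite mem_rcons -mem1 => /tw.
- by apply/hasP; exists x => //; rewrite belast_rcons -mem1.
- by rewrite last_rcons.
have := ec; rewrite -(rot_cycle i) Dc /= Dp cat_path /= => /and3P[ep1 elb ep2].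
(* Empty [p2] means that [w] goes into the arc closing the cycle. *)
case/lastP: p2 => [|p2 z] in Dp ep2.
  rewrite cats1 in Dp; have [Dc1 Db] := rcons_inj Dp.
  exists (y :: rcons p1 w).
    by rewrite /= !rcons_path last_rcons ep1 e1 Db.
  apply/permP=> f; rewrite /= -cats1 count_cat /=.
  by have := permP prot f; rewrite Dc Dc1 /=; clear; lia.
rewrite -rcons_cons -rcons_cat in Dp; have [Dc1 Dz] := rcons_inj Dp.
exists (y :: p1 ++ w :: b :: p2).
  rewrite /= rcons_cat cat_path /= ep1 e1 e2 /=.
  by rewrite Dz.
apply/permP=> f; rewrite /= count_cat /=.
by have := permP prot f; rewrite Dc Dc1 /= count_cat /=; clear; lia.
Qed.

(* Longest cycle: if no single vertex can be inserted, the outside splits into the vertices dominated by the cycle and those dominating it, and strength gives an arc a -> b from the former to the latter; then a, b can be inserted together. *)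
Lemma hamilton_cycle (T : finType) (e : rel T) (S : {set T}) (z : T) :
  z \in S -> e z z ->
  {in S &, forall x y, x != y -> e x y || e y x} ->
  (forall X : {set T}, X \subset S -> X != set0 -> X != S ->
     exists x y, [/\ x \in X, y \in S :\: X & e x y]) ->
  exists s, [/\ uniq (z :: s), z :: s =i S & path e z (rcons s z)].
Proof.
move=> zS ezz tot cut.
suff [c [ec uc cS]] : exists c, [/\ cycle e c, uniq c & c =i S].
  have zc : z \in c by rewrite cS.
  have [i s Ds] := rot_to zc; exists s; split.
  - by rewrite -Ds rot_uniq.
  - by move=> x; rewrite -Ds mem_rot cS.
  - by move: ec; rewrite -(rot_cycle i) Ds.
have grow (c : seq T) : c != [::] -> cycle e c -> uniq c -> {subset c <= S} -> size c < #|S| ->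
    exists c', [/\ cycle e c', uniq c', {subset c' <= S} & size c < size c'].
  move=> c0 ec uc sub ltc.
  have cE : #|[set x in c]| = size c by rewrite cardsE; apply/card_uniqP.
  have cneq : [set x in c] != S by apply: contraTneq ltc => <-; rewrite cE ltnn.
  have csub : [set x in c] \subset S by apply/subsetP=> x; rewrite inE => /sub.
  have [x0 x0c] : exists x0, x0 \in c.
    by case: (c) c0 => // x ? _; exists x; rewrite mem_head.
  have neq w a : w \notin c -> a \in c -> a != w.
    by move=> wc ac; apply: contraNneq wc => <-.
  (* A vertex of [X] that also dominates some cycle vertex can be inserted. *)
  pose X := [set w in S | (w \notin c) && has (fun a => e a w) c].
  have [/existsP[w /andP[wX /hasP[y yc ewy]]]|noins] :=
      boolP [exists w, (w \in X) && has (e w) c].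
    move: wX; rewrite inE => /and3P[wS wc /hasP[x xc exw]].
    have tw : {in c, forall a, e a w || e w a}.
      by move=> a ac; apply: tot; [exact: sub|exact: wS|exact: neq].
    have [c' ec' pc'] := cycle_insert tw ec xc exw yc ewy.
    exists c'; split=> //; last by rewrite (perm_size pc').
      by rewrite (perm_uniq pc') /= wc.
    by move=> a; rewrite (perm_mem pc') inE => /predU1P[->|/sub].
  have XN a y : a \in X -> y \in c -> ~~ e a y.
    move=> aX yc; apply: contraNN noins => eay; apply/existsP; exists a.
    by rewrite aX; apply/hasP; exists y.
  (* Strength is used twice: an arc leaving the cycle shows that [X] is nonempty, then an arc
     leaving [X] ends in some [b] that dominates the whole cycle. *)
  have [|x1 [a0 [x1c]]] := cut _ csub _ cneq.
    by apply/set0Pn; exists x0; rewrite inE.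
  rewrite !inE in x1c *; case/andP=> a0c a0S ex1.
  have a0X : a0 \in X by rewrite inE a0S a0c; apply/hasP; exists x1.
  have [|||a [b [aX]]] := cut X.
  - by apply/subsetP=> w; rewrite inE => /andP[].
  - by apply/set0Pn; exists a0.
  - by apply: contraTneq (sub _ x0c) => <-; rewrite inE x0c andbF.
  rewrite inE => /andP[bX bS] eab.
  have bc : b \notin c by apply: contraTN eab => /(XN a b aX).
  have bN y : y \in c -> e b y.
    move=> yc; have := tot _ _ bS (sub _ yc); rewrite eq_sym neq // => /(_ isT).
    case/orP=> // eyb; case/negP: bX; rewrite inE bS bc.
    by apply/hasP; exists y.
  have [aS ac] : a \in S /\ a \notin c by move: aX; rewrite inE => /and3P[].
  have aN y : y \in c -> e y a.
    move=> yc; have := tot _ _ aS (sub _ yc); rewrite eq_sym neq // => /(_ isT).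
    by rewrite (negPf (XN _ _ aX yc)).
  have ab : a != b by apply: contraNneq bX => <-.
  case Dc: c => [|x c1]; first by rewrite Dc in c0.
  rewrite Dc in ec uc sub ac bc aN bN.
  exists [:: x, a, b & c1]; split=> //=.
  - rewrite aN ?mem_head // eab /=; case: (c1) ec bN => [|y c2] /=.
      by move=> _ ->; rewrite ?mem_head.
    by case/andP=> _ -> ->; rewrite // !inE eqxx orbT.
  - move: uc ac bc; rewrite /= !inE !negb_or => /andP[-> ->] /andP[ax ->] /andP[bx ->].
    by rewrite ab eq_sym ax eq_sym bx.
  - by move=> w; rewrite !inE => /or4P[/eqP->|/eqP->|/eqP->|wc] //; apply: sub; rewrite inE ?eqxx ?wc ?orbT.
have loop n (c : seq T) : c != [::] -> cycle e c -> uniq c -> {subset c <= S} ->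
    #|S| - size c < n -> exists c, [/\ cycle e c, uniq c & c =i S].
  elim: n c => // n IH c c0 ec uc sub ltn.
  have [le_S|lt_S] := leqP #|S| (size c).
    exists c; split=> //; have [||_ h] := uniq_min_size (s2 := enum S) uc.
    - by move=> x /sub; rewrite mem_enum.
    - by rewrite -cardE.
    by move=> x; rewrite h mem_enum.
  have [c' [ec' uc' sub' lt']] := grow c c0 ec uc sub lt_S.
  apply: (IH c') => //; last by lia.
  by rewrite -size_eq0 -lt0n (leq_ltn_trans _ lt').
(* The loop [e z z] makes the single vertex [z] a cycle to start from. *)
apply: (loop #|S|.+1 [:: z]) => //=; first by rewrite ezz.
- by move=> x; rewrite inE => /eqP->.
- by lia.
Qed.

(** * Merging two paths, and elementary facts on tournaments and strength *)

Lemma merge_paths (T : eqType) (e : rel T) (x v : T) (s t : seq T) :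
  (forall a b, a != b -> e a b || e b a) ->
  path e x (rcons s v) -> path e x (rcons t v) -> uniq (s ++ t) ->
  exists2 r, path e x (rcons r v) & perm_eq r (s ++ t).
Proof.
move=> tot; have [n] := ubnP (size s + size t).
elim: n x s t => // n IH x [|a s] [|b t] ltn; try by move=> *; exists [::].
- by move=> _ pt _; exists (b :: t).
- by move=> ps _ _; rewrite cats0; exists (a :: s).
move=> /= /andP[exa ps] /andP[exb pt] /andP[nas us].
(* As in merge sort, the dominating head comes first; it then precedes both the rest of its own path
   and the other path. *)
have /tot/orP[eab|eba] : a != b.
  by apply: contraNneq nas => ->; rewrite mem_cat mem_head orbT.
  have [r pr Er] : exists2 r, path e a (rcons r v) & perm_eq r (s ++ b :: t).
    apply: IH => //=; first by move: ltn => /=; lia.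
  by exists (a :: r); rewrite /= ?exa ?perm_cons.
have [r pr Er] : exists2 r, path e b (rcons r v) & perm_eq r ((a :: s) ++ t).
  apply: IH => //=; first by move: ltn => /=; lia.
    by rewrite eba.
  have : uniq ((a :: s) ++ [:: b] ++ t) by rewrite /= nas us.
  by rewrite uniq_catCA => /= /andP[].
exists (b :: r); rewrite /= ?exb //.
rewrite -cat_cons -(cat1s b t) perm_sym perm_catCA /= perm_cons perm_sym.
exact: Er.
Qed.

Lemma tournament_total (V : finType) (arc : rel V) :
  tournament arc -> forall x y, x != y -> arc x y || arc y x.
Proof. by case=> _ h x y /h; case: (arc x y). Qed.

Lemma tournament_asym (V : finType) (arc : rel V) :
  tournament arc -> forall x y, arc x y -> ~~ arc y x.
Proof.
case=> irr h x y axy; have /h : x != y by apply: contraTneq axy => ->.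
by rewrite axy.
Qed.

Lemma tournament_flip (V : finType) (arc : rel V) :
  tournament arc -> forall x y, x != y -> ~~ arc x y -> arc y x.
Proof. by move=> tT x y /(tournament_total tT)/orP[->|]. Qed.

Lemma strong_on_cut (V : finType) (arc : rel V) (S X : {set V}) :
  strong_on arc S -> X \subset S -> X != set0 -> X != S ->
  exists x y, [/\ x \in X, y \in S :\: X & arc x y].
Proof.
move=> sS XS /set0Pn[x xX] neq.
have /subsetPn[y yS yX] : ~~ (S \subset X).
  by apply: contraNN neq => SX; rewrite eqEsubset XS.
have /connectP[p pp Ey] := sS x y (subsetP XS x xX) yS.
rewrite {y yS}Ey in yX.
elim: p x xX pp yX => [|y p IH] x xX /=; first by rewrite xX.
case/andP=> /and3P[axy _ yS] pp; have [yX|yX _] := boolP (y \in X); first exact: IH.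
by exists x, y; rewrite inE yX.
Qed.

(** * Linkages and their translation into containers *)

Lemma uniq_size_card (T : finType) (s : seq T) : uniq s -> size s <= #|T|.
Proof. by move/card_uniqP <-; apply: max_card. Qed.

(* A path is represented by its interior s, a (possibly empty) segment: the path itself is u :: rcons s v. *)
Definition linkage (V : finType) (arc : rel V) (u v : V) (F : seq (seq V)) :=
  uniq (u :: v :: flatten F) && all (fun s => path arc u (rcons s v)) F.

Lemma linkage_perm (V : finType) (arc : rel V) (u v : V) (F F' : seq (seq V)) :
  perm_eq F F' -> linkage arc u v F = linkage arc u v F'.
Proof.
move=> FF'; rewrite /linkage (perm_all _ FF'); congr (_ && _).
by apply: perm_uniq; rewrite !perm_cons perm_flatten.
Qed.

Lemma perm_pick2 (T : eqType) (F : seq T) (s t : T) :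
  s \in F -> t \in F -> s != t -> exists F1, perm_eq F (s :: t :: F1).
Proof.
move=> sF tF st; have t1 : t \in rem s F.
  by have := perm_mem (perm_to_rem sF) t; rewrite inE tF eq_sym (negPf st).
exists (rem t (rem s F)); apply: perm_trans (perm_to_rem sF) _.
by rewrite perm_cons perm_to_rem.
Qed.

Lemma uniq_flatten_nth (T : eqType) (F : seq (seq T)) (i j : nat) (x : T) :
  uniq (flatten F) -> i < size F -> j < size F ->
  x \in nth [::] F i -> x \in nth [::] F j -> i = j.
Proof.
elim: F i j => // s F IH [|i] [|j] //=; rewrite cat_uniq !ltnS => /and3P[_ /hasPn ds uF].
- move=> _ lj xs xj; have /ds : x \in flatten F.
    by apply/flattenP; exists (nth [::] F j); rewrite ?mem_nth.
  by rewrite xs.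
- move=> li _ xi xs; have /ds : x \in flatten F.
    by apply/flattenP; exists (nth [::] F i); rewrite ?mem_nth.
  by rewrite xs.
- by move=> li lj xi xj; congr S; apply: IH.
Qed.

Lemma uniq_of_flatten (T : eqType) (F : seq (seq T)) :
  [::] \notin F -> uniq (flatten F) -> uniq F.
Proof.
elim: F => //= s F IH; rewrite inE negb_or cat_uniq => /andP[s0 F0] /and3P[_ ds uF].
rewrite IH // andbT; case: s s0 ds => // x s _; apply: contraNN => sF.
apply/hasP; exists x; last by rewrite /= mem_head.
by apply/flattenP; exists (x :: s); rewrite ?mem_head.
Qed.

(** [uniq F] is a separate hypothesis because [flatten] does not see repeated empty segments, that
    is, repeated use of the arc from [u] to [v]. [F != [::]] ensures that [u] and [v] lie on some
    path. *)
Lemma linkage_container (V : finType) (arc : rel V) (u v : V) (F : seq (seq V)) :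
  F != [::] -> uniq F -> linkage arc u v F -> u :: v :: flatten F =i predT ->
  container arc (size F) u v [seq u :: rcons s v | s <- F].
Proof.
move=> F0 uF /andP[/= /and3P[]]; rewrite inE negb_or => /andP[uv uN] vN ufl /allP pF cov.
split.
- by rewrite size_map.
- by rewrite map_inj_uniq // => s t [/rcons_inj[]].
- move=> _ /mapP[s sF ->]; exists (rcons s v); split=> //; split; first exact: pF.
  split; first by rewrite last_rcons.
  have sub : {subset s <= flatten F} by move=> x xs; apply/flattenP; exists s.
  rewrite /= mem_rcons inE negb_or uv (contra (sub u)) // rcons_uniq.
  rewrite (contra (sub v)) //=.
  have /(nthP [::])[i li <-] := sF.
  elim: (F) i ufl li => //= t G IH [|i]; rewrite cat_uniq => /and3P[? _ ?] //; exact: IH.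
- move=> i j; rewrite size_map => li lj ij x; rewrite !(nth_map [::]) //.
  rewrite !inE !mem_rcons !inE.
  case/or3P=> [/eqP->|/eqP->|xi]; [by left|by right|].
  case/or3P=> [/eqP->|/eqP->|xj]; [by left|by right|].
  by case/eqP: ij; apply: uniq_flatten_nth xi xj.
have mem0 x s : s \in F -> x \in u :: rcons s v ->
    exists2 t, t \in [seq u :: rcons s v | s <- F] & x \in t.
  by move=> sF xs; exists (u :: rcons s v); rewrite // map_f.
have [s0 s0F] : exists s0, s0 \in F.
  by case: (F) F0 => // s ? _; exists s; rewrite mem_head.
move=> x; have := cov x; rewrite !inE => /or3P[/eqP->|/eqP->|/flattenP[s sF xs]].
- by apply: (mem0 _ s0); rewrite ?mem_head.
- by apply: (mem0 _ s0); rewrite // inE mem_rcons mem_head orbT.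
- by apply: (mem0 _ s); rewrite // inE mem_rcons inE xs !orbT.
Qed.

(** * Saturating a linkage and absorbing the uncovered vertices *)

Lemma not_sorted_split (T : Type) (r : rel T) (s : seq T) :
  ~~ sorted r s -> exists s1 a b s2, s = s1 ++ [:: a, b & s2] /\ ~~ r a b.
Proof.
case: s => //= x s; elim: s x => //= b s IH x; rewrite negb_and.
have [rxb /=|nr _] := boolP (r x b); last by exists [::], x, b, s.
by case/IH=> s1 [a [c [s2 [-> nr]]]]; exists (x :: s1), a, c, s2.
Qed.

(* The sorting relation fails exactly at the places where the uncovered vertex w can be inserted; being transitive, it also relates non-consecutive vertices of s. *)
Definition saturated (V : finType) (arc : rel V) (u v : V) (F : seq (seq V)) :=
  forall w s, w \notin u :: v :: flatten F -> s \in F ->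
    sorted (fun a b => arc a w ==> arc b w) s.

(** Each insertion keeps the number of segments and lengthens [flatten F], whose size is at most
    [#|V|], so the process stops. *)
Lemma saturated_linkage (V : finType) (arc : rel V) (u v : V) (F : seq (seq V)) :
  tournament arc -> [::] \notin F -> linkage arc u v F ->
  exists F', [/\ size F' = size F, [::] \notin F', linkage arc u v F' &
    saturated arc u v F'].
Proof.
move=> tT; have [n] := ubnP (#|V| - size (flatten F)).
elim: n F => // n IH F ltn F0 lF.
have [/existsP[w /andP[wN /hasP[s sF ns]]]|sat] :=
  boolP [exists w, (w \notin u :: v :: flatten F) &&
     has (fun s => ~~ sorted (fun a b => arc a w ==> arc b w) s) F]; last first.
  exists F; split=> // w s wN sF; apply: contraR sat => ns.
  by apply/existsP; exists w; rewrite wN; apply/hasP; exists s.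
have pF := perm_to_rem sF; move: (rem s F) pF => F1 pF.
have [s1 [a [b [s2 [Ds]]]]] := not_sorted_split ns.
rewrite negb_imply => /andP[aw nbw].
have wb : arc w b.
  apply: (tournament_flip tT) => //; apply: contraNneq wN => <-.
  rewrite !inE; apply/orP; right; apply/orP; right.
  by apply/flattenP; exists s; rewrite // Ds mem_cat !inE eqxx !orbT.
pose s' := s1 ++ [:: a, w, b & s2].
have pfl : perm_eq (flatten (s' :: F1)) (w :: flatten F).
  apply/permP=> f; have := permP (perm_flatten pF) f.
  by rewrite /= /s' Ds !count_cat /=; clear; lia.
have [|||F' [EF ? ? ?]] := IH (s' :: F1); last first.
- by exists F'; split=> //; rewrite EF (perm_size pF).
- move: (lF); rewrite (linkage_perm _ _ _ pF) => /andP[_ /andP[ps psF]].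
  apply/andP; split.
    have /perm_uniq-> : perm_eq (u :: v :: flatten (s' :: F1)) (w :: u :: v :: flatten F).
      by apply/permP=> f; have /= := permP pfl f; clear; lia.
    by rewrite cons_uniq wN /=; case/andP: lF.
  apply/andP; split; last exact: psF.
  move: ps; rewrite /s' Ds !rcons_cat !cat_path /=.
  by case/and4P=> -> -> _ ->; rewrite aw wb.
- move: F0; rewrite (perm_mem pF) !inE !negb_or => /andP[_ ->].
  by rewrite /s'; case: (s1).
have := perm_size pfl; rewrite /= => Es.
have : uniq (flatten (s' :: F1)).
  rewrite (perm_uniq pfl) /=; move: wN; rewrite !inE !negb_or => /and3P[_ _ ->].
  by case/andP: lF => /= /and3P[].
by move/uniq_size_card; rewrite /= Es => lt1; rewrite subnSK.
Qed.

(* Contract the vertices of the segments to a single vertex None and take a Hamiltonian cycle of the resulting strong semicomplete digraph. *)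
Lemma hamilton_path_outside (V : finType) (arc : rel V) (u v : V) (F : seq (seq V)) :
  tournament arc -> u != v -> strong_on arc (~: [set u; v]) ->
  u \notin flatten F -> v \notin flatten F -> flatten F != [::] ->
  ~ (u :: v :: flatten F =i predT) ->
  exists x p, [/\ uniq (x :: p), path arc x p,
    x :: p =i [predC u :: v :: flatten F],
    exists2 a, a \in flatten F & arc a x &
    exists2 b, b \in flatten F & arc (last x p) b].
Proof.
move=> tT uv sD uN vN; set C := flatten F in uN vN * => C0 ncov.
have [c0 c0C] : exists c, c \in C.
  by case: (C) C0 => // c ? _; exists c; rewrite mem_head.
have CD a : a \in C -> a \in ~: [set u; v].
  by move=> aC; rewrite !inE negb_or; apply/andP; split;
     apply: contraTneq aC => ->.
pose W := [predC u :: v :: C].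
have WD a : a \in W -> a \in ~: [set u; v].
  by rewrite !inE !negb_or => /and3P[-> ->].
have WC a : a \in W -> a \notin C by rewrite !inE !negb_or => /and3P[].
have DWC a : a \in ~: [set u; v] -> a \notin C -> a \in W.
  by rewrite !inE !negb_or => /andP[-> ->] ->.
(* The loop at [None] is the one [hamilton_cycle] asks for at its base point. *)
pose e (a b : option V) := match a, b with
  | Some a, Some b => arc a b
  | None, Some b => has (fun c => arc c b) C
  | Some a, None => has (arc a) C
  | None, None => true end.
pose S : {set option V} := [set o | if o is Some a then a \in W else true].
have totC w : w \in W -> has (fun c => arc c w) C || has (arc w) C.
  move=> wW; have /(tournament_total tT)/orP[h|h] : c0 != w.
  - by apply: contraTneq c0C => ->; apply: WC.
  - by apply/orP; left; apply/hasP; exists c0.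
  - by apply/orP; right; apply/hasP; exists c0.
have [|||X XS X0 XneS|s [us sS es]] := @hamilton_cycle _ e S None.
- by rewrite inE.
- by [].
- move=> [a|] [b|]; rewrite !inE //.
  + by move=> _ _ ab; apply: (tournament_total tT); apply: contraNneq ab => ->.
  + by move=> /totC; rewrite orbC.
  + by move=> _ /totC.
(* A cut [X] is pulled back to the vertices of the tournament, with all of [C] on the side of
   [None]; an arc leaving the pullback gives one leaving [X]. *)
- pose Y := [set a | Some a \in X].
  have YW a : a \in Y -> a \in W by rewrite inE => /(subsetP XS); rewrite inE.
  have [NX|NX] := boolP (None \in X).
    have [||| a [b [aY]]] := @strong_on_cut _ _ _ (Y :|: [set a in C]) sD.
    + apply/subsetP=> a; rewrite inE [a \in [set _ in C]]inE.
      by case/orP=> [/YW/WD|/CD].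
    + by apply/set0Pn; exists c0; rewrite inE [c0 \in [set _ in C]]inE c0C orbT.
    + apply: contra_neq XneS => YE; apply/eqP; rewrite eqEsubset XS.
      apply/subsetP=> -[a|//]; rewrite inE => aW.
      have := WD _ aW; rewrite -YE inE [a \in [set _ in C]]inE (negPf (WC _ aW)) orbF.
      by rewrite inE.
    rewrite in_setD in_setU negb_or [b \in [set _ in C]]inE => /andP[/andP[bY bC] bD] ab.
    have bX : Some b \in S :\: X.
      rewrite in_setD; rewrite inE in bY; rewrite bY inE; exact: DWC.
    move: aY; rewrite in_setU [a \in [set _ in C]]inE => /orP[aY|aC].
      by exists (Some a), (Some b); split=> //; rewrite inE in aY.
    by exists None, (Some b); split=> //; apply/hasP; exists a.
  have [||| a [b [aY]]] := @strong_on_cut _ _ _ Y sD.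
  + by apply/subsetP=> a /YW/WD.
  + case/set0Pn: X0 => -[a aX|]; last by rewrite (negPf NX).
    by apply/set0Pn; exists a; rewrite inE.
  + apply: contraTneq (CD _ c0C) => <-; apply/negP=> /YW/WC.
    by rewrite c0C.
  rewrite in_setD => /andP[bY bD] ab; rewrite inE in aY.
  have [bC|bC] := boolP (b \in C).
    exists (Some a), None; split=> //; first by rewrite in_setD NX inE.
    by apply/hasP; exists b.
  exists (Some a), (Some b); split=> //; rewrite in_setD.
  by rewrite inE in bY; rewrite bY inE; apply: DWC.
(* By uniqueness [None] occurs only as the base point, so opening the cycle there leaves a path of
   original vertices. *)
have [t Dt] : exists t, s = map Some t.
  move: us => /= /andP[+ _]; elim: s {sS es} => [|[x|] s IH]; first by exists [::].
    by rewrite inE => /IH[t ->]; exists (x :: t).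
  by rewrite mem_head.
have tW : t =i W.
  move=> a; have := sS (Some a); rewrite Dt !inE /= => <-.
  by rewrite mem_map // => ? ? [].
case: t => [|x p] in Dt tW.
  case: ncov => a; rewrite [RHS]inE; apply: negbNE.
  by have := tW a; rewrite inE => <-.
have up : uniq (x :: p).
  by move: us; rewrite Dt cons_uniq => /andP[_]; rewrite map_inj_uniq // => ? ? [].
exists x, p; move: es; rewrite Dt /= rcons_path => /and3P[/hasP[a aC ax] pp lp].
split=> //; last 2 first.
- by exists a.
- by move: lp; rewrite last_map => /hasP[b bC lb]; exists b.
move: pp; elim: (p) (x) => //= y q IH z /andP[-> /IH]; exact.
Qed.

Lemma first_switch (T : Type) (g : pred T) (x : T) (p : seq T) :
  g x -> ~~ g (last x p) ->
  exists p1 b p2, [/\ p = p1 ++ b :: p2, g (last x p1) & ~~ g b].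
Proof.
elim: p x => [|b p IH] x gx /=; first by rewrite gx.
have [gb|ngb _] := boolP (g b); last by exists [::], b, p.
by case/(IH b gb)=> p1 [c [p2 [-> h1 h2]]]; exists (b :: p1), c, p2.
Qed.

(* Two segments s1, s2 with arcs last s1 -> x and last p -> head s2 are joined through the path x :: p covering the outside. If the only choice is s1 = s2 = s, then x dominates all other segments, which all dominate last p. Cutting x :: p at the last place where it can still enter one of two other segments r1, r2, say r_i, gives the single segment r_j (second part) s (first part) r_i. *)
Lemma absorb_outside (V : finType) (arc : rel V) (u v : V) (k : nat)
    (F : seq (seq V)) :
  tournament arc -> u != v -> strong_on arc (~: [set u; v]) ->
  2 <= k -> size F = k.+1 -> [::] \notin F ->
  linkage arc u v F -> saturated arc u v F ->
  ~ (u :: v :: flatten F =i predT) ->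
  exists F', [/\ size F' = k \/ size F' = k.-1, [::] \notin F',
    linkage arc u v F' & u :: v :: flatten F' =i predT].
Proof.
move=> tT uv sD k2 sF F0 lF satF ncov.
have /andP[/= /and3P[]] := lF; rewrite inE negb_or => /andP[_ uN] vN uF /allP pF.
have C0 : flatten F != [::].
  case: (F) sF F0 => // -[|a s] G //=.
have [x [p [uxp pp xpW [a aC ax] [b bC lb]]]] :=
  hamilton_path_outside tT uv sD uN vN C0 ncov.
have outE w : (w \in x :: p) = (w \notin u :: v :: flatten F) by rewrite xpW.
have outN w : w \in x :: p -> w \notin u :: v :: flatten F by rewrite outE.
have outC w c s : w \in x :: p -> s \in F -> c \in s -> c != w.
  move=> /outN wN sF' cs; apply: contraNneq wN => <-; rewrite !inE.
  by apply/orP; right; apply/orP; right; apply/flattenP; exists s.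
pose start (s : seq V) := head u s; pose stop (s : seq V) := last u s.
have ne s : s \in F -> exists h t, s = h :: t.
  by case: s => [|h t]; [move=> h; rewrite h in F0|exists h, t].
have trW w : transitive (fun c d => arc c w ==> arc d w).
  by move=> d c f; case: (arc c w) => //=; case: (arc d w).
(* By saturation, domination of [w] persists along [s] up to its last vertex; [outof] is the mirror
   statement for the first vertex. *)
have into w c s : w \in x :: p -> s \in F -> c \in s -> arc c w -> arc (stop s) w.
  move=> wW sF' cs cw; have := satF w s (outN _ wW) sF'; rewrite /stop.
  case/splitPr: cs => s1 s2 /cat_sorted2[_ /= /(order_path_min (trW w)) /allP h].
  rewrite last_cat /=; have := mem_last c s2; rewrite inE => /predU1P[->//|/h].
  by rewrite cw.
have outof w d s : w \in x :: p -> s \in F -> d \in s -> arc w d -> arc w (start s).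
  move=> wW sF' ds wd; have [h [t Ds]] := ne s sF'.
  apply: (tournament_flip tT); first by rewrite (outC _ _ _ wW sF') // Ds mem_head.
  apply/negP; rewrite /start Ds /= => hw; have := satF w s (outN _ wW) sF'.
  rewrite Ds /= => /(order_path_min (trW w)) /allP ht.
  move: (ds); rewrite Ds inE => /predU1P[dh|/ht].
    by have := tournament_asym tT hw; rewrite -dh wd.
  by rewrite hw /= => dw; have := tournament_asym tT dw; rewrite wd.
have enter s y : s \in F -> arc y (start s) -> path arc y s.
  move=> sF' ys; have := pF s sF'; have [h [t Ds]] := ne s sF'.
  by rewrite rcons_path; move: ys; rewrite Ds /start /= => -> /andP[/andP[_ ->]].
have lastE s y : s \in F -> last y s = stop s.
  by move=> /ne[h [t ->]].
have exit s : s \in F -> arc (stop s) v.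
  by move=> /pF; rewrite rcons_path => /andP[].
have enter0 s : s \in F -> path arc u s.
  by move=> /pF; rewrite rcons_path => /andP[].
have stop_in s : s \in F -> stop s \in s.
  by move=> /ne[h [t ->]]; exact: (mem_last h t).
have start_in s : s \in F -> start s \in s.
  by move=> /ne[h [t ->]]; exact: (mem_head h t).
(* The permutation hypothesis says that [q] uses up exactly [x :: p] and the segments dropped from
   [F]; disjointness and full coverage both follow. *)
have build q F1 : q != [::] -> {subset F1 <= F} ->
    perm_eq (q ++ flatten F1) ((x :: p) ++ flatten F) ->
    path arc u (rcons q v) ->
    [/\ [::] \notin q :: F1, linkage arc u v (q :: F1) &
      u :: v :: flatten (q :: F1) =i predT].
  move=> q0 subF pq pathq.
  have pall : perm_eq (u :: v :: flatten (q :: F1)) ((x :: p) ++ u :: v :: flatten F).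
    apply/permP=> f; have := permP pq f.
    by rewrite /= !count_cat /=; clear; lia.
  split.
  - by rewrite inE negb_or eq_sym q0 (contra (subF [::])).
  - apply/andP; split.
      rewrite (perm_uniq pall) cat_uniq uxp andTb; apply/andP; split; last by case/andP: lF.
      by apply/hasPn=> w wC; change (w \notin x :: p); rewrite outE negbK.
    by apply/andP; split=> //; apply/allP=> s /subF/pF.
  - by move=> w; rewrite (perm_mem pall) mem_cat outE orNb.
have [s1 s1F as1] := flattenP aC; have [s2 s2F bs2] := flattenP bC.
have e1 : arc (stop s1) x by apply: into ax; rewrite ?mem_head.
have e2 : arc (last x p) (start s2) by apply: outof lb; rewrite ?mem_last.
have [/hasP[s sF' /hasP[s' s'F /and3P[ss' sx ls']]]|nopair] :=
    boolP (has (fun s => has (fun s' =>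
      [&& s != s', arc (stop s) x & arc (last x p) (start s')]) F) F).
  have [F1 pF1] := perm_pick2 sF' s'F ss'.
  have [||||] := build (s ++ (x :: p) ++ s') F1.
  - by case: (s).
  - by move=> t tF; rewrite (perm_mem pF1) !inE tF !orbT.
  - apply/permP=> f; have := permP (perm_flatten pF1) f.
    by rewrite /= !count_cat /= !count_cat; clear; lia.
  - rewrite rcons_path !cat_path !last_cat /= enter0 // -/(stop s) sx pp /=.
    by rewrite (lastE s') // exit // enter.
  exists ((s ++ (x :: p) ++ s') :: F1); split=> //; left.
  by have := perm_size pF1; rewrite sF /= => -[->].
have {}nopair s s' : s \in F -> s' \in F -> s != s' ->
    arc (stop s) x -> arc (last x p) (start s') -> False.
  move=> sF' s'F ss' sx ls'; case/hasP: nopair; exists s => //.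
  by apply/hasP; exists s' => //; rewrite ss' sx ls'.
have Es : s2 = s1 by apply/eqP; apply: contraT; rewrite eq_sym => /nopair-[].
rewrite {s2 s2F bs2}Es in e2.
have uniqF : uniq F by apply: uniq_of_flatten.
(* Since [k >= 2], there are at least two segments besides [s1]. *)
have := perm_to_rem s1F; case: (rem s1 F) => [|r1 [|r2 F1]] pF1;
  try by have := perm_size pF1; rewrite sF /=; move: k2; clear; lia.
have := uniqF; rewrite (perm_uniq pF1) /= !inE !negb_or.
case/and4P=> /and3P[s1r1 s1r2 _] /andP[r12 _] _ _.
have r1F : r1 \in F by rewrite (perm_mem pF1) !inE eqxx !orbT.
have r2F : r2 \in F by rewrite (perm_mem pF1) !inE eqxx !orbT.
(* If the last vertex of [r] dominated [x], then [r] and [s1] would contradict [nopair]. So [x]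
   dominates it, and hence the first vertex of [r] by [outof]. *)
have xr r : r \in F -> s1 != r -> arc x (start r).
  move=> rF sr; apply: (outof _ (stop r)) => //; first by rewrite mem_head.
    exact: stop_in.
  apply: (tournament_flip tT); first by apply: (outC _ _ r) => //; [rewrite mem_head|exact: stop_in].
  by apply/negP=> rx; apply: (nopair r s1) => //; rewrite eq_sym.
have nlr r : r \in F -> s1 != r -> ~~ arc (last x p) (start r).
  by move=> rF sr; apply/negP; apply: (nopair s1 r).
(* [g] holds at [x] and fails at [last x p]. Where it switches off, [last x p1] can enter [r1] or
   [r2], while [b0] can enter neither and so is dominated by the last vertices of both. *)
pose g w := arc w (start r1) || arc w (start r2).
have [|| p1 [b0 [p2 [Dp g1]]]] := @first_switch _ g x p.
- by rewrite /g xr.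
- by rewrite /g negb_or !nlr.
rewrite negb_or => /andP[n1 n2].
have b0W : b0 \in x :: p by rewrite Dp inE mem_cat mem_head !orbT.
have rb r : r \in F -> ~~ arc b0 (start r) -> arc (stop r) b0.
  move=> rF nb; apply: (into _ (start r)) => //; first exact: start_in.
  apply: (tournament_flip tT) => //; rewrite eq_sym.
  by apply: (outC _ _ r) => //; apply: start_in.
(* Three of the [k + 1] segments become one, so [k - 1] remain. *)
have join r r' : r \in F -> r' \in F -> perm_eq F [:: s1, r, r' & F1] ->
    arc (last x p1) (start r) -> arc (stop r') b0 ->
  exists F', [/\ size F' = k \/ size F' = k.-1, [::] \notin F',
    linkage arc u v F' & u :: v :: flatten F' =i predT].
  move=> rF r'F pr lr rb0.
  have [||||] := build (r' ++ (b0 :: p2) ++ s1 ++ (x :: p1) ++ r) F1.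
  - by case: (r').
  - by move=> t tF; rewrite (perm_mem pr) !inE tF !orbT.
  - apply/permP=> f; have := permP (perm_flatten pr) f.
    by rewrite Dp /=; do 3!rewrite !count_cat /=; clear; lia.
  - move: pp e2; rewrite Dp cat_path last_cat /= => /and3P[pp1 _ pp2] e2.
    rewrite rcons_path; do 3!rewrite ?(cat_path, last_cat) /=.
    rewrite enter0 // -/(stop r') rb0 pp2 /=.
    by rewrite (lastE s1) // (lastE r) // enter // e1 pp1 enter // exit.
  exists ((r' ++ (b0 :: p2) ++ s1 ++ (x :: p1) ++ r) :: F1); split=> //; right.
  by have := perm_size pr; rewrite sF /= => -[->].
case/orP: g1 => g1; first by apply: (join r1 r2) => //; apply: rb.
apply: (join r2 r1) => //; last exact: rb.
apply: perm_trans pF1 _; rewrite perm_cons.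
exact: (permEl (perm_catCA [:: r1] [:: r2] F1)).
Qed.

(** * Existence of [k + 1] paths, and the final assembly *)

Lemma strong_on_out (V : finType) (arc : rel V) (S : {set V}) (x y : V) :
  strong_on arc S -> x \in S -> y \in S -> x != y ->
  exists2 z, z \in S & arc x z.
Proof.
move=> sS xS yS xy; have /connectP[[|z p]] := sS x y xS yS.
  by move=> _ yx; rewrite yx eqxx in xy.
by move=> /andP[/and3P[xz _ zS] _] _; exists z.
Qed.

(** Menger's theorem is applied between out-neighbours of [u] and in-neighbours of [v], with [u] and
    [v] excluded. Against a separator [S] of size at most [k], strength is used twice: deleting [v]
    and [S] gives a first step from [u] to some [a], and deleting [u] and [S] gives a route from [a]
    to [v]. *)
Lemma initial_linkage (V : finType) (arc : rel V) (u v : V) (k : nat) :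
  tournament arc -> u != v -> 2 <= k -> m_strong arc (2 * k) ->
  exists F, [/\ size F = k.+1, [::] \notin F & linkage arc u v F].
Proof.
move=> tT uv k2 [Vk strong].
pose e : rel V := [rel a b | [&& arc a b, b != u & b != v]].
pose A := [set a | [&& arc u a, a != u & a != v]].
pose B := [set b | arc b v && (b != u)].
have [S sepS|F [sF uF FP]] := @menger V e A B k.+1.
  rewrite ltnNge; apply/negP=> Sk.
  (* At most [k + 1] vertices are deleted, and [k + 1 < 2 * k] as [k >= 2]. *)
  have cS (w z : V) : #|w |: (S :\ z)| < 2 * k.
    have := cardsU1 w (S :\ z); have := subset_leq_card (subsetDl S [set z]).
    by case: (_ \notin _) => /=; move: k2 Sk; clear; lia.
  have [y yN] : exists y, y \in ~: (u |: (v |: S)).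
    apply/card_gt0P; have := cardsC (u |: (v |: S)).
    rewrite cardsU1 [#|v |: S|]cardsU1.
    by move: Vk k2 Sk; clear; lia.
  have [a aN ua] : exists2 a, a \in ~: (v |: (S :\ u)) & arc u a.
    apply: (strong_on_out (y := y) (strong _ (cS v u))).
    - by rewrite !inE negb_or uv eqxx.
    - by move: yN; rewrite !inE !negb_or => /and3P[-> -> ->].
    - by apply: contraTneq yN => ->; rewrite !inE eqxx.
  have au : a != u by apply: contraTneq ua => ->; case: tT.
  move: aN; rewrite !inE au !negb_or /= => /andP[av aS].
  have /connectP[p ep lp] : connect [rel c d | [&& arc c d,
      c \in ~: (u |: (S :\ v)) & d \in ~: (u |: (S :\ v))]] a v.
    apply: (strong _ (cS u v)); rewrite !inE negb_or ?au ?av ?(negPf aS) //.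
    by rewrite eq_sym uv eqxx.
  (* The route is cut just before its first visit to [v]. *)
  have [q [eq qB qS]] : exists q, [/\ path e a q, last a q \in B & ~~ has (mem S) (a :: q)].
    move: (conj au (conj av aS)); clear ua au av aS.
    elim: p a ep lp => [|b p IH] a /=; first by move=> _ -> [_ []]; rewrite eqxx.
    move=> /andP[/and3P[ab _ bN] ep] lp [au [av aS]].
    have [bv|bv] := eqVneq b v.
      by exists [::]; rewrite /= inE au -bv ab orbF.
    move: bN; rewrite !inE bv negb_or /= => /andP[bu bS].
    have [q [eq qB qS]] := IH b ep lp (conj bu (conj bv bS)).
    by exists (b :: q); split; [rewrite /= eq andbT; apply/and3P|exact: qB|rewrite [has _ _]/= negb_or aS].
  case/negP: qS; apply: sepS => //.
  by rewrite inE ua au av.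
have nF : [::] \notin F by apply/negP=> /FP[x [p []]].
exists F; split=> //.
have sub w : w \in flatten F -> w != u /\ w != v.
  case/flattenP=> s /FP[x [p [-> xA ep _]]].
  have /and3P[_ xu xv] : [&& arc u x, x != u & x != v] by move: xA; rewrite inE.
  elim: p x {xA} ep xu xv => [|b p IH] x /=; first by rewrite inE => _ xu xv /eqP->.
  case/andP=> /and3P[_ bu bv] ep xu xv; rewrite inE => /predU1P[->//|].
  exact: IH.
apply/andP; split.
  rewrite /= inE negb_or uv uF !andbT /=; apply/andP; split.
    by apply/negP=> /sub[]; rewrite eqxx.
  by apply/negP=> /sub[_]; rewrite eqxx.
apply/allP=> s /FP[x [p [-> xA ep lB]]].
move: xA lB; rewrite !inE => /and3P[ux _ _] /andP[lv _].
rewrite /= ux rcons_path lv andbT.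
by apply: sub_path ep => c d /and3P[].
Qed.

Lemma container_of_arc (V : finType) (arc : rel V) (u v : V) (k : nat) :
  2 <= k -> tournament arc -> m_strong arc (2 * k) -> arc u v ->
  exists P, container arc k u v P.
Proof.
move=> k2 tT sT auv.
have uv : u != v by apply: contraTneq auv => ->; case: tT.
have sD : strong_on arc (~: [set u; v]).
  by apply: sT.2; rewrite cards2 uv; move: k2; clear; lia.
have [F0 [sF0 nF0 lF0]] := initial_linkage tT uv k2 sT.
have [F [sF nF lF satF]] := saturated_linkage tT nF0 lF0.
rewrite {F0 nF0 lF0}sF0 in sF.
have finish G : size G = k -> uniq G -> linkage arc u v G ->
    u :: v :: flatten G =i predT -> exists P, container arc k u v P.
  move=> sG uG lG cG; exists [seq u :: rcons s v | s <- G].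
  rewrite -sG; apply: linkage_container => //.
  by rewrite -size_eq0 sG; move: k2; clear; case: k.
have uniqG G : [::] \notin G -> linkage arc u v G -> uniq G.
  by move=> nG /andP[/= /and3P[_ _ /(uniq_of_flatten nG)]].
have [cov|ncov] := boolP [forall x, x \in u :: v :: flatten F].
  case: F => [|s [|t F]] // in sF nF lF satF cov *; first by case: (k) k2 sF.
  have ust : uniq (s ++ t).
    case/andP: lF => /= /and3P[_ _]; rewrite catA cat_uniq => /and3P[] //.
  have /and3P[ps pt pF] := (andP lF).2.
  have [r pr Er] := merge_paths (tournament_total tT) ps pt ust.
  have pfl : perm_eq (u :: v :: flatten (r :: F)) (u :: v :: flatten [:: s, t & F]).
    by rewrite !perm_cons /= catA perm_cat2r.
  have lG : linkage arc u v (r :: F).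
    by apply/andP; rewrite (perm_uniq pfl); split; [case/andP: lF|rewrite /= pr].
  apply: (finish (r :: F)) => //.
  - by case: sF.
  - apply: uniqG => //; move: nF; rewrite !inE !negb_or => /and3P[s0 _ ->].
    by rewrite andbT eq_sym -size_eq0 (perm_size Er) size_cat; move: s0; case: (s).
  - by move=> x; rewrite (perm_mem pfl); apply: (forallP cov).
have [|G [szG nG lG cG]] := absorb_outside tT uv sD k2 sF nF lF satF.
  by move=> cov; case/negP: ncov; apply/forallP=> x; rewrite cov.
case: szG => szG; first exact: (finish G) (uniqG G nG lG) lG cG.
(* The empty segment stands for the arc from [u] to [v]; it is new because all segments of [G] are
   nonempty. *)
apply: (finish ([::] :: G)) => //.
- by rewrite /= szG prednK //; move: k2; clear; case: k.
- by rewrite /= nG uniqG.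
- by case/andP: lG => uG pG; rewrite /linkage /= auv pG /= andbT.
Qed.

Theorem theorem3p1 (V : finType) (arc : rel V) (k : nat) :
  2 <= k -> tournament arc -> m_strong arc (2 * k) ->
  kstar_strongly_connected arc k.
Proof.
move=> k2 tT sT u v uv; case/orP: (tournament_total tT uv) => auv.
  by have [P cP] := container_of_arc k2 tT sT auv; exists P; left.
by have [P cP] := container_of_arc k2 tT sT auv; exists P; right.
Qed.
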